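(* Let $X$ be a $T_1$ space. If the Alexandroff duplicate $A(X)$ of $X$ is star-Lindelöf, then $X$ has countable extent.
   Context: The extent of $X$ is $e(X)=\sup\{|Y| : Y \text{ is a closed and discrete subspace of } X\}$; $X$ has countable extent if $e(X)\leq\omega$, i.e. every closed discrete subspace is countable. The Alexandroff duplicate of $X$ is $A(X)=X\times\{0,1\}$, where each point of $X\times\{1\}$ is isolated and a basic neighbourhood of $\langle x,0\rangle$ is a set of the form $(U\times\{0\})\cup((U\times\{1\})\setminus\{\langle x,1\rangle\})$ with $U$ a neighbourhood of $x$ in $X$. For a subset $A$ of a space $Z$ and a collection $\mathcal{P}$ of subsets of $Z$, $St(A,\mathcal{P})=\bigcup\{B\in\mathcal{P} : A\cap B\neq\emptyset\}$. $Z$ is star-Lindelöf if for every open cover $\mathcal{U}$ of $Z$ there is a countable $\mathcal{V}\subseteq\mathcal{U}$ with $St(\bigcup\mathcal{V},\mathcal{U})=Z$. *)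

(* Defs.v *)
From HB Require Import structures.
From mathcomp Require Import all_boot.
From mathcomp Require Import all_classical topology.

Set Implicit Arguments.
Unset Strict Implicit.
Unset Printing Implicit Defensive.

Local Open Scope classical_set_scope.

(* Y coerces to the subtype [set_type Y], which the library equips with the
   subspace topology; the equation is the library's definition of a discrete
   topology ([Discrete_ofNbhs]). *)
Definition discrete_subspace (X : topologicalType) (Y : set X) : Prop :=
  @nbhs Y Y = principal_filter.

Definition countable_extent (X : topologicalType) : Prop :=
  forall Y : set X, closed Y -> discrete_subspace Y -> countable Y.

(* An alias of X * bool, with false for 0 and true for 1, which does not
   inherit the product topology. *)
Definition alexandroff_duplicate (X : Type) : Type := (X * bool)%type.

Section AlexandroffDuplicate.
Variable X : topologicalType.
Local Notation AX := (alexandroff_duplicate X).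

HB.instance Definition _ := Choice.copy AX (X * bool)%type.

Definition duplicate_basic_nbhs (x : X) (U : set X) : set AX :=
  (U `*` [set false]) `|` ((U `*` [set true]) `\ (x, true)).

Definition duplicate_nbhs (p : AX) : set_system AX :=
  if p.2 then principal_filter p
  else filter_from (nbhs p.1) (duplicate_basic_nbhs p.1).

(* A set is open when it contains a basic neighbourhood of each of its points.
   This is a topology on the duplicate of any space, but [duplicate_nbhs p] is
   its neighbourhood filter only when X is T1 (see [nbhs_duplicateE]): otherwise
   a basic neighbourhood of (x, 0) need not contain one of (y, 0), y != x. *)
Definition duplicate_open : set_system AX :=
  [set A | A `<=` duplicate_nbhs^~ A].

Let duplicate_nbhs_filter (p : AX) : Filter (duplicate_nbhs p).
Proof.
case: p => x [] /=; rewrite /duplicate_nbhs /=; first exact: _.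
apply: filter_from_filter; first by exists setT; exact: filterT.
move=> U V xU xV; exists (U `&` V); first exact: filterI.
move=> [y b] /= [[[Uy Vy] yb]|[[[Uy Vy] yb] yx]].
  by split; left.
by split; right.
Qed.

Let duplicate_openT : duplicate_open setT.
Proof. by move=> p _; apply: (@filterT _ _ (duplicate_nbhs_filter p)). Qed.

Let duplicate_openI : setI_closed duplicate_open.
Proof.
move=> A B oA oB p [Ap Bp].
by apply: (@filterI _ _ (duplicate_nbhs_filter p)); [exact: oA|exact: oB].
Qed.

Let duplicate_open_bigU (I : Type) (f : I -> set AX) :
  (forall i, duplicate_open (f i)) -> duplicate_open (\bigcup_i f i).
Proof.
move=> of_ p [i _ fip].
by apply: (@filterS _ _ (duplicate_nbhs_filter p) (f i));
  [move=> q fiq; exists i|exact: of_].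
Qed.

HB.instance Definition _ := isOpenTopological.Build AX
  duplicate_openT duplicate_openI duplicate_open_bigU.

Lemma open_duplicateE : @open AX = duplicate_open.
Proof. by []. Qed.

Lemma nbhs_duplicateE (p : AX) :
  accessible_space X -> nbhs p = duplicate_nbhs p.
Proof.
move=> T1; apply/seteqP; split => A.
  rewrite nbhsE => -[B [oB Bp] BA].
  exact: (@filterS _ _ (duplicate_nbhs_filter p) B A BA (oB p Bp)).
case: p => x []; rewrite /duplicate_nbhs /=.
  move/principal_filterP => Ap; rewrite nbhsE.
  exists [set (x, true)]; last by move=> _ ->.
  split => //; rewrite open_duplicateE => _ ->.
  exact/principal_filterP.
move=> [U xU UA]; rewrite nbhsE.
exists (duplicate_basic_nbhs x (interior U)); last first.
  move=> q /= [[/interior_subset qU q0]|[[/interior_subset qU q1] qx]].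
    by apply: UA; left.
  by apply: UA; right.
split; last by left; split=> //; exact: nbhs_interior.
rewrite open_duplicateE.
move=> [y b] /= [[/= yU ->]|[[/= yU ->] yx]]; last first.
  by apply/principal_filterP; right.
rewrite /duplicate_nbhs /=.
have yU' : nbhs y (interior U) := nbhs_interior yU.
have [<-|yx] := eqVneq y x; first by exists (interior U).
have xC : nbhs y (~` [set x]).
  apply: open_nbhs_nbhs; split; last by apply/eqP.
  by apply: closed_openC; apply: accessible_closed_set1.
exists (interior U `&` ~` [set x]); first exact: filterI.
move=> [z c] /= [[[/= zU zx] ->]|[[[/= zU zx] ->] _]]; first by left.
by right; split => //= -[].
Qed.

End AlexandroffDuplicate.

Definition star (T : Type) (A : set T) (P : set (set T)) : set T :=
  \bigcup_(B in [set B | P B /\ A `&` B !=set0]) B.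

Definition star_lindelof (Z : topologicalType) : Prop :=
  forall U : set (set Z), U `<=` open -> \bigcup_(B in U) B = setT ->
  exists V : set (set Z),
    [/\ V `<=` U, countable V & star (\bigcup_(B in V) B) U = setT].

(* Main.v *)
(* For a closed discrete Y, the set Y * {1} is closed in A(X) and consists of
   isolated points. In the open cover made of its singletons and its complement,
   the singletons meet no other member, so a subfamily whose star is everything
   contains them all. *)
Require Import Defs.
From mathcomp Require Import all_boot.
From mathcomp Require Import all_classical topology.

Local Open Scope classical_set_scope.

Lemma discrete_subspace_nbhs (X : topologicalType) (Y : set X) (y : X) :
  discrete_subspace Y -> Y y -> exists2 U, nbhs y U & U `&` Y `<=` [set y].
Proof.
move=> dY Yy; pose y' : Y := exist _ y (mem_set Yy).
have : nbhs y' [set y'] by rewrite dY; exact/principal_filterP.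
(* Open sets of the subspace are preimages under the inclusion, so the one inside [[set y']] is the
   trace of an open [O] of [X]. *)
move=> [_ [[O oO <-] Oy' Osub]].
exists O; first by apply: open_nbhs_nbhs; split.
move=> z [Oz Yz].
by have /(congr1 val) := Osub (exist _ z (mem_set Yz)) Oz.
Qed.

Lemma open_duplicate_isolated (X : topologicalType) (x : X) :
  open [set (x, true) : alexandroff_duplicate X].
Proof. by rewrite open_duplicateE => _ ->; exact/principal_filterP. Qed.

(** The complement is open: over [Y], discreteness gives [U] meeting [Y] at most in [x], and the
    basic neighbourhood of [(x, false)] deletes exactly [(x, true)]; off [Y], the complement of [Y]
    serves as [U]. *)
Lemma closed_duplicate_copy (X : topologicalType) (Y : set X) :
  closed Y -> discrete_subspace Y ->
  closed (Y `*` [set true] : set (alexandroff_duplicate X)).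
Proof.
move=> cY dY; rewrite -openC open_duplicateE => -[x [nYx|_]].
  exact/principal_filterP.
rewrite /duplicate_nbhs /=; have [Yx|nYx] := pselect (Y x).
  have [U xU UY] := discrete_subspace_nbhs _ _ _ dY Yx.
  exists U => // -[z b] [[_ /= ->] []//|[[Uz /= ->]]] zx [/= Yz _].
  by apply: zx; rewrite (UY z).
exists (~` Y); first by apply: open_nbhs_nbhs; split=> //; exact: closed_openC.
by move=> [z b] [[nYz _]|[[nYz _] _]] [].
Qed.

Theorem theorem4p26 (X : topologicalType) (T1X : accessible_space X)
  (slAX : star_lindelof (alexandroff_duplicate X)) : countable_extent X.
Proof.
move=> Y cY dY.
pose pt (y : X) : set (alexandroff_duplicate X) := [set (y, true)].
pose Y1 : set (alexandroff_duplicate X) := Y `*` [set true].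
pose cover := (pt @` Y) `|` [set ~` Y1].
have coverE y B : Y y -> cover B -> B (y, true) -> B = pt y.
  by move=> Yy [[z _ <-] [->]|-> []].
have [| |V [Vcover cV stV]] := slAX cover.
- move=> _ [[y _ <-]|->]; first exact: open_duplicate_isolated.
  by apply: closed_openC; exact: closed_duplicate_copy.
- rewrite -subTset => p _; have [[Yp p1]|nY1p] := pselect (Y1 p).
    exists (pt p.1); first by left; exists p.1.
    by rewrite /pt /= -p1 -surjective_pairing.
  by exists (~` Y1) => //; right.
have ptV : pt @` Y `<=` V.
  move=> _ [y Yy <-].
  have : star (\bigcup_(B in V) B) cover (y, true) by rewrite stV.
  (* [B] contains [(y, true)], hence is [pt y]; its common point [q] with some [C] in [V] is then
     [(y, true)], which forces [C] to be [pt y] as well. *)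
  move=> [B [cB [q [[C VC Cq] Bq]]] By].
  move: Bq; rewrite (coverE y B Yy cB By) => qy.
  by rewrite -(coverE y C Yy (Vcover _ VC)) // -qy.
have pt_inj : {in Y &, injective pt}.
  by move=> y z _ _ yz; have [] : pt z (y, true) by rewrite -yz.
(* By injectivity [Y] is equinumerous with its image under [pt], a subset of the countable [V]. *)
rewrite -(eq_countable (inj_card_eq pt_inj)).
exact: sub_countable (subset_card_le ptV) cV.
Qed.
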